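(* Let $\Theta=(V,E)$ be a finite directed graph which is either a finite tree directed toward a root or a finite directed cycle. Then $\mathrm{encost}_{r,\epsilon}(\Theta)=1$ for every $r\in\mathbb{N}$ and every $\epsilon>0$.
   Context: $\mathbb{F}$ is the free group of rank two with fixed free generators $a,b$, identity $e$, word length $|\cdot|$, and $\mathbb{B}_r=\{g\in\mathbb{F}:|g|\le r\}$. For $d\in\mathbb{N}$ and finite $F\subseteq\mathbb{F}$, a function $\mathsf{C}:F\to\mathrm{Mat}_{d\times d}(\mathbb{C})$ is positive definite if $\sum_{g,h\in S}\alpha(h)^\ast\mathsf{C}(h^{-1}g)\alpha(g)\ge 0$ for every $S\subseteq\mathbb{F}$ with $S^{-1}S\subseteq F$ and every $\alpha:S\to\mathbb{C}^d$; it is strictly positive definite if moreover equality holds only for $\alpha\equiv 0$; it is normalized if $\mathsf{C}(e)=\mathbf{I}_d$. A function on all of $\mathbb{F}$ is (strictly) positive definite if all its restrictions to finite sets are. $\mathrm{NSPD}(r,d)$ denotes the set of normalized strictly positive definite functions $\mathbb{B}_r\to\mathrm{Mat}_{d\times d}(\mathbb{C})$. Realizations: for $\mathsf{C}\in\mathrm{NSPD}(2s,d)$ (note $\mathbb{B}_s^{-1}\mathbb{B}_s=\mathbb{B}_{2s}$) there is a Hilbert space $\mathscr{X}(\mathsf{C})$ and $\Phi_\mathsf{C}:\mathbb{B}_s\to\mathscr{X}(\mathsf{C})^d$ with $\langle\Phi_\mathsf{C}(g)_j,\Phi_\mathsf{C}(h)_k\rangle=\mathsf{C}(h^{-1}g)_{j,k}$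 for all $g,h\in\mathbb{B}_s$, $j,k\in[d]$, whose coordinates span (and are linearly independent in) $\mathscr{X}(\mathsf{C})$. For $\mathsf{C},\mathsf{D}\in\mathrm{NSPD}(2s,d)$ the transport operator $t[\mathsf{C},\mathsf{D}]:\mathscr{X}(\mathsf{C})\to\mathscr{X}(\mathsf{D})$ is the linear map sending $\sum_{g\in\mathbb{B}_s}\sum_j\alpha(g)_j\Phi_\mathsf{C}(g)_j$ to $\sum_{g\in\mathbb{B}_s}\sum_j\alpha(g)_j\Phi_\mathsf{D}(g)_j$, and the relative energy $\mathfrak{e}(\mathsf{C},\mathsf{D})$ is the square of its operator norm (relative energies of normalized strictly positive definite functions on a ball $\mathbb{B}_r$ are understood via this definition, with realizations indexed by the ball $\mathbb{B}_s$ satisfying $\mathbb{B}_s^{-1}\mathbb{B}_s\subseteq\mathbb{B}_r$ as in the paper). For strictly positive definite $\mathsf{C},\mathsf{D}:\mathbb{F}\to\mathrm{Mat}_{d\times d}(\mathbb{C})$, $\mathfrak{e}(\mathsf{C},\mathsf{D})=\sup_r\mathfrak{e}(\mathsf{C}\upharpoonright\mathbb{B}_r,\mathsf{D}\upharpoonright\mathbb{B}_r)$ (possibly $\infty$). A $d$-dimensional radius-$r$ configuration over a finite directed graph $\Theta=(V,E)$ is a family $\mathbf{C}=(\mathsf{C}_v)_{v\in V}$ of elements of $\mathrm{NSPD}(r,d)$. For $\epsilon>0$, $\mathrm{encost}_\epsilon(\mathbf{C})$ is the infimum of all $M\in[1,\infty)$ such that there exist positive definite $\hat{\mathsf{C}}_v:\mathbb{F}\to\mathrm{Mat}_{d\times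 d}(\mathbb{C})$ ($v\in V$) with $\max(\mathfrak{e}(\mathsf{C}_v,\hat{\mathsf{C}}_v\upharpoonright\mathbb{B}_r),\mathfrak{e}(\hat{\mathsf{C}}_v\upharpoonright\mathbb{B}_r,\mathsf{C}_v))\le 1+\epsilon$ for all $v$ and $\mathfrak{e}(\hat{\mathsf{C}}_v,\hat{\mathsf{C}}_w)-1\le M(\mathfrak{e}(\mathsf{C}_v,\mathsf{C}_w)-1)$ for all $(v,w)\in E$ (with $\inf\emptyset=\infty$). Then $\mathrm{encost}_{r,\epsilon}(\Theta)=\sup_{\mathbf{C}}\mathrm{encost}_\epsilon(\mathbf{C})$, the supremum over all $d\in\mathbb{N}$ and all $d$-dimensional radius-$r$ configurations over $\Theta$. *)

(* Defs.v *)
From mathcomp Require Import all_boot all_order all_algebra.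
From mathcomp Require Import all_classical all_reals ereal.
From mathcomp Require Import complex.
From mathcomp Require Import Rstruct.

Set Implicit Arguments.
Unset Strict Implicit.
Unset Printing Implicit Defensive.
Import Order.TTheory GRing.Theory Num.Theory.
Local Open Scope ring_scope.
Local Open Scope classical_set_scope.

Notation RR := Rdefinitions.R.
Notation CC := (Rdefinitions.R)[i].

(** * The free group F of rank two on a, b.
    A letter is (generator, inverted?) : false = a, true = b.
    Group elements are the reduced words. *)
Definition letter := (bool * bool)%type.
Definition linv (x : letter) : letter := (x.1, ~~ x.2).
Definition letters : seq letter :=
  [:: (false, false); (false, true); (true, false); (true, true)].

Definition word := seq letter.

Definition reduced (w : word) : bool :=
  if w is x :: w' then path (fun x y => y != linv x) x w' else true.

Definition winv (w : word) : word := rev (map linv w).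
Definition push (x : letter) (w : word) : word :=
  if w is y :: w' then (if y == linv x then w' else x :: w) else [:: x].
Definition wmul (u v : word) : word := foldr push v u.

Definition in_ball (r : nat) (g : word) : bool := reduced g && (size g <= r)%N.

Fixpoint words_of_len (n : nat) : seq word :=
  if n is n'.+1 then [seq x :: w | x <- letters, w <- words_of_len n']
  else [:: [::]].
Definition ball_seq (s : nat) : seq word :=
  [seq w <- flatten [seq words_of_len n | n <- iota 0 s.+1] | reduced w].

(** * Positive definiteness.
    A finite subset S of F is a duplicate-free list of reduced words;
    alpha : S -> C^d is given by a function word -> column vector. *)
Definition Qform (d : nat) (C : word -> 'M[CC]_d) (S : seq word)
    (alpha : word -> 'cV[CC]_d) : CC :=
  \sum_(g <- S) \sum_(h <- S)
     ((map_mx Num.conj (alpha h))^T *m C (wmul (winv h) g) *m alpha g) ord0 ord0.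

Definition admissible (F : pred word) (S : seq word) : bool :=
  uniq S && all reduced S &&
  all (fun h => all (fun g => F (wmul (winv h) g)) S) S.

(** positive definite on the finite set F (only values on F matter) *)
Definition posdef_on (F : pred word) (d : nat) (C : word -> 'M[CC]_d) : Prop :=
  forall S alpha, admissible F S -> 0 <= Qform C S alpha.

Definition strict_posdef_on (F : pred word) (d : nat) (C : word -> 'M[CC]_d)
  : Prop :=
  posdef_on F C /\
  forall S alpha, admissible F S -> Qform C S alpha = 0 ->
    forall g, g \in S -> alpha g = 0.

(** positive definite on all of F: all restrictions to finite sets are *)
Definition posdef (d : nat) (C : word -> 'M[CC]_d) : Prop :=
  posdef_on reduced C.

Definition NSPD (r d : nat) (C : word -> 'M[CC]_d) : Prop :=
  strict_posdef_on (in_ball r) C /\ C [::] = 1%:M.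

(** * Relative energy on the ball B_r, realizations indexed by B_s, s = r/2.
    Squared operator norm of the transport operator
    sum alpha Phi_C  |->  sum alpha Phi_D, i.e. the least M >= 0 with
    ||t x||^2 <= M ||x||^2 for all x  (+oo if no such M exists). *)
Definition energy_r (r d : nat) (C D : word -> 'M[CC]_d) : \bar RR :=
  ereal_inf [set M%:E | M in [set M : RR | 0 <= M /\
    forall alpha : word -> 'cV[CC]_d,
      complex.Re (Qform D (ball_seq r./2) alpha)
        <= M * complex.Re (Qform C (ball_seq r./2) alpha)]].

Definition energy (d : nat) (C D : word -> 'M[CC]_d) : \bar RR :=
  ereal_sup [set energy_r r C D | r in [set: nat]].

Definition encost_conf (r : nat) (eps : RR) (V : finType) (E : rel V) (d : nat)
    (Cs : V -> word -> 'M[CC]_d) : \bar RR :=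
  ereal_inf [set M%:E | M in [set M : RR | 1 <= M /\
    exists Ch : V -> word -> 'M[CC]_d,
      (forall v, posdef (Ch v)) /\
      (forall v, energy_r r (Cs v) (Ch v) <= (1 + eps)%:E /\
                 energy_r r (Ch v) (Cs v) <= (1 + eps)%:E)%E /\
      (forall v w, E v w ->
         energy (Ch v) (Ch w) - 1%E <= M%:E * (energy_r r (Cs v) (Cs w) - 1%E))%E]].

Definition encost (r : nat) (eps : RR) (V : finType) (E : rel V) : \bar RR :=
  ereal_sup [set x | exists (d : nat) (Cs : V -> word -> 'M[CC]_d),
    (forall v, NSPD r (Cs v)) /\ x = encost_conf r eps E Cs].

Definition rooted_in_tree (V : finType) (E : rel V) : Prop :=
  exists root : V,
    (forall w, ~~ E root w) /\
    (forall v, v != root -> #|[pred w | E v w]| = 1%N) /\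
    (forall v, connect E v root).

Definition directed_cycle (V : finType) (E : rel V) : Prop :=
  (0 < #|V|)%N /\
  exists f : V -> V, injective f /\ (forall x y, E x y = (y == f x)) /\
    (forall x y, fconnect f x y).

(* Main.v *)
Require Import Defs.
From mathcomp Require Import all_boot all_order all_algebra.
From mathcomp Require Import all_classical all_reals ereal.
From mathcomp Require Import complex.
From mathcomp Require Import Rstruct.
From mathcomp Require Import sesquilinear spectral ring.

(** Write [s] for the integer half of [r].  A function that is positive definite
    on the ball of radius [2s] has a finite-dimensional realization [P] on the
    ball of radius [s]; the partial isometries [P g |-> P (x g)], [x] a generator,
    extend to unitaries, and the resulting representation of the free group
    yields a positive definite extension to the whole group.

    If [L] is the relative energy of an edge [v -> w], then
    [E_v = C_v - C_w / L] is positive definite, so it extends, and it suffices to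
    find extensions with [Ch_v = Ch_w / L + Eh_v].  As every vertex has at most one
    outgoing edge this linear system is solved by iteration: along a tree it
    stops at the root, and around a cycle it closes up with the factor
    [1 - prod (1 / L)].  When that factor vanishes, all [E_v] are positive
    definite with value [0] at the identity, hence all [C_v] coincide.  The
    extensions are exact and satisfy the energy inequalities with [M = 1]. *)

Set Implicit Arguments.
Unset Strict Implicit.
Unset Printing Implicit Defensive.
Import Order.TTheory GRing.Theory Num.Theory.
Local Open Scope ring_scope.
Local Open Scope sesquilinear_scope.

(** * Unitaries with prescribed values and Gram factorizations in finite dimension *)

Section LinearAlgebra.
Variable K : numClosedFieldType.

Lemma trmxC_mul m n p (A : 'M[K]_(m, n)) (B : 'M[K]_(n, p)) :
  (A *m B) ^t* = B ^t* *m A ^t*.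
Proof. by rewrite trmx_mul map_mxM. Qed.

Lemma trmxCB m n (A B : 'M[K]_(m, n)) : (A - B) ^t* = A ^t* - B ^t*.
Proof. by rewrite linearB /= map_mxB. Qed.

Lemma trmxCZ m n (c : K) (A : 'M[K]_(m, n)) : (c *: A) ^t* = c^* *: A ^t*.
Proof. by apply/matrixP=> i j; rewrite !mxE rmorphM. Qed.

Lemma trmxC_sum (I : Type) (r : seq I) m n (F : I -> 'M[K]_(m, n)) :
  (\sum_(i <- r) F i) ^t* = \sum_(i <- r) (F i) ^t*.
Proof. by rewrite linear_sum raddf_sum. Qed.

Lemma dotmx_col_ge0 n (v : 'cV[K]_n) : 0 <= (v ^t* *m v) ord0 ord0.
Proof.
by rewrite mxE sumr_ge0 // => i _; rewrite !mxE mulrC mul_conjC_ge0.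
Qed.

Lemma dotmx_mx_eq0 m n (A : 'M[K]_(m, n)) : A ^t* *m A = 0 -> A = 0.
Proof.
move=> A0; apply/matrixP=> i j; rewrite [RHS]mxE.
move/matrixP/(_ j j): A0; rewrite !mxE => /eqP; rewrite psumr_eq0; last first.
  by move=> k _; rewrite !mxE mulrC mul_conjC_ge0.
by move=> /allP/(_ i); rewrite mem_index_enum !mxE mulrC mul_conjC_eq0 => /(_ isT)/eqP.
Qed.

Lemma unitarymx_mulCl n (U : 'M[K]_n) : U \is unitarymx -> U ^t* *m U = 1%:M.
Proof. by move/unitarymxP/mulmx1C. Qed.

Lemma unitarymx1 n : (1%:M : 'M[K]_n) \is unitarymx.
Proof. by apply/unitarymxP; rewrite trmx1 map_mx1 mulmx1. Qed.

(* The complex Householder reflection along [a - b], with the coefficient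
   [1 / <a - b, a>] in place of [2 / |a - b|^2]. *)
Lemma unitary_reflection n (a b : 'cV[K]_n) :
  a ^t* *m a = b ^t* *m b ->
  exists2 H : 'M[K]_n, H \is unitarymx &
    H *m a = b /\ forall x : 'cV_n, (a - b) ^t* *m x = 0 -> H *m x = x.
Proof.
move=> eqab; have [v vE] : {v | v = a - b} by exists (a - b).
rewrite -vE; pose s := (v ^t* *m a) ord0 ord0.
have vaE : v ^t* *m a = s%:M by rewrite [LHS]mx11_scalar.
(* Since [a] and [b] have equal norm, |a - b|^2 is twice the real part of <a - b, a>; this is what
   makes the reflection unitary. *)
have vvE : v ^t* *m v = (s + s^*)%:M.
  have -> : (s + s^*)%:M = v ^t* *m a + (v ^t* *m a) ^t* :> 'M_1.
    rewrite vaE raddfD; congr (_ + _).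
    by rewrite tr_scalar_mx map_scalar_mx.
  by rewrite trmxC_mul trmxCK vE mulmxBr trmxCB !mulmxBl mulmxBr eqab opprB.
have [s0|s0] := eqVneq s 0.
  have v0 : v = 0 by apply: dotmx_mx_eq0; rewrite vvE s0 conjC0 addr0 raddf0.
  exists 1%:M; first exact: unitarymx1.
  by split=> [|x _]; rewrite mul1mx //; apply/eqP; rewrite -subr_eq0 -vE v0.
exists (1%:M - s^-1 *: (v *m v ^t*)); last split.
- apply/unitarymxP; rewrite trmxCB trmx1 map_mx1 trmxCZ.
  rewrite trmxC_mul trmxCK mulmxBr mulmx1 mulmxBl mul1mx.
  rewrite -scalemxAl -scalemxAr -mulmxA (mulmxA (v ^t*)) vvE mul_scalar_mx.
  rewrite -scalemxAr !scalerA opprB -addrA addrA addrAC -!addrA -!scaleNr -!scalerDl.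
  rewrite -[RHS]addr0; congr (_ + _); rewrite -[RHS](scale0r (v *m v ^t*)).
  have sc0 : s^* != 0 by rewrite conjC_eq0.
  by congr (_ *: _); rewrite fmorphV /=; field; rewrite s0 sc0.
- rewrite mulmxBl mul1mx -scalemxAl -mulmxA vaE mul_mx_scalar scalerA mulVf //.
  by rewrite scale1r vE opprB addrC subrK.
- move=> x vx; rewrite mulmxBl mul1mx -scalemxAl -mulmxA vx mulmx0 scaler0.
  by rewrite subr0.
Qed.

(** Induction on the list: if [U] matches the tail, a reflection takes [U *m a] to [b]. It fixes
    every target [p.2] of the tail, because the Gram condition makes [p.2] orthogonal to
    [U *m a - b]. *)
Lemma unitary_of_equal_gram n (l : seq ('cV[K]_n * 'cV[K]_n)) :
  {in l &, forall p q, p.1 ^t* *m q.1 = p.2 ^t* *m q.2} ->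
  exists2 U : 'M[K]_n, U \is unitarymx & {in l, forall p, U *m p.1 = p.2}.
Proof.
elim: l => [|[a b] l IHl] gram.
  by exists 1%:M => //; exact: unitarymx1.
have [|U uU UE] := IHl.
  by move=> p q pl ql; apply: gram; rewrite inE ?pl ?ql orbT.
have UU x y : (U *m x) ^t* *m (U *m y) = x ^t* *m y :> 'M_1.
  by rewrite trmxC_mul -mulmxA (mulmxA (U ^t*)) unitarymx_mulCl ?mul1mx.
have [|H uH [Ha Hx]] := @unitary_reflection _ (U *m a) b.
  by rewrite UU; apply: (gram (a, b) (a, b)); rewrite mem_head.
exists (H *m U); first exact: mul_unitarymx.
move=> p; rewrite inE => /predU1P[->|pl]; rewrite -mulmxA //=.
rewrite Hx ?UE // trmxCB mulmxBl -UE // UU UE //.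
by rewrite (gram (a, b) p) ?subrr // inE ?eqxx ?pl ?orbT.
Qed.

(** The entries of the block products are the inner products of columns, so the vector case applies
    to the list of all columns. *)
Lemma unitary_of_equal_block_gram (T : eqType) (S : seq T) n d
    (A B : T -> 'M[K]_(n, d)) :
  {in S &, forall h g, A h ^t* *m A g = B h ^t* *m B g} ->
  exists2 U : 'M[K]_n, U \is unitarymx & {in S, forall g, U *m A g = B g}.
Proof.
move=> gram.
pose l := [seq (col k (A g), col k (B g)) | g <- S, k <- enum 'I_d].
have gramE (M N : 'M[K]_(n, d)) i j :
    (col i M) ^t* *m col j N = ((M ^t* *m N) i j)%:M.
  rewrite [LHS]mx11_scalar; congr (_%:M); rewrite !mxE.
  by apply: eq_bigr => k _; rewrite !mxE.
have [|U uU UE] := @unitary_of_equal_gram _ l.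
  move=> p q /allpairsP[[h i] [/= hS _ ->]] /allpairsP[[g j] [/= gS _ ->]].
  by rewrite !gramE gram.
exists U => // g gS; apply/matrixP=> i k.
have /UE/= : (col k (A g), col k (B g)) \in l.
  by apply/allpairsP; exists (g, k); rewrite /= mem_enum.
by rewrite !colE mulmxA -!colE => /colP/(_ i); rewrite !mxE.
Qed.

(* The [B g] are coordinate projections onto the summands of a direct sum of
   copies of [K^d] indexed by [S]. *)
Lemma block_coordinates (T : choiceType) (S : seq T) d :
  exists n (B : T -> 'M[K]_(d, n)),
    {in S &, forall h g, B h *m B g ^t* = (h == g)%:R%:M}.
Proof.
pose I := (seq_sub S * 'I_d)%type.
pose e g (k : 'I_d) (p : I) : K := ((val p.1 == g) && (p.2 == k))%:R.
exists #|{: I}|, (fun g => \matrix_(k, a) e g k (enum_val a)).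
move=> h g hS gS; apply/matrixP=> k l; rewrite !mxE.
under eq_bigr do rewrite !mxE /e conjC_nat -natrM mulnb.
rewrite -(big_enum_val (A := {: I})
  (fun p : I => (((val p.1 == h) && (p.2 == k)) && ((val p.1 == g) && (p.2 == l)))%:R)).
have [<-|neq_hg] := eqVneq h g; last first.
  rewrite mul0rn big1 // => p _; case: eqP => //= ->.
  by rewrite (negPf neq_hg) andbF.
have [<-|neq_kl] := eqVneq k l; last first.
  rewrite big1 // => p _; case: (p.2 =P k) => [->|]; rewrite ?andbF //.
  by rewrite (negPf neq_kl) !andbF.
rewrite (bigD1 (SeqSub hS, k)) //= !eqxx big1 ?addr0 // => -[q m].
by rewrite -pair_eqE /= -val_eqE /= andbb => /negPf->.
Qed.

Lemma normalmx_spectralE n (G : 'M[K]_n) : G \is normalmx ->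
  G = (spectralmx G) ^t* *m diag_mx (spectral_diag G) *m spectralmx G.
Proof.
by move=> /orthomx_spectralP {1}->; rewrite invmx_unitary // spectral_unitarymx.
Qed.

(** The witness is a unit eigenvector; eigenvalues thereby inherit the sign or reality of the
    quadratic form. *)
Lemma spectral_diag_form n (G : 'M[K]_n) (i : 'I_n) : G \is normalmx ->
  exists x : 'cV[K]_n,
    spectral_diag G ord0 i = (x ^t* *m G *m x) ord0 ord0.
Proof.
move=> /normalmx_spectralE GE; set P := spectralmx G in GE.
have PP : P *m P ^t* = 1%:M by apply/unitarymxP/spectral_unitarymx.
exists (P ^t* *m delta_mx i ord0); rewrite {2}GE trmxC_mul trmxCK.
rewrite !mulmxA -(mulmxA _ P (P ^t*)) PP mulmx1.
rewrite -(mulmxA _ P (P ^t*)) PP mulmx1.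
rewrite trmx_delta map_delta_mx -rowE -colE !mxE eqxx.
by rewrite mulr1n.
Qed.

(** The order forces the form to be real. The difference of [G ^t*] and [G] is skew-Hermitian, hence
    normal, and each of its eigenvalues has the shape y^* - y with [y] a value of the form, so it
    vanishes. *)
Lemma psd_hermitian n (G : 'M[K]_n) :
  (forall x : 'cV[K]_n, 0 <= (x ^t* *m G *m x) ord0 ord0) -> G ^t* = G.
Proof.
move=> G_ge0; apply/eqP; rewrite -subr_eq0; apply/eqP; set A := _ - _.
have A_normal : A \is normalmx.
  apply/normalmxP; rewrite /A trmxCB trmxCK -(opprB (G ^t*) G).
  by rewrite mulmxN mulNmx.
have D0 i : spectral_diag A ord0 i = 0.
  have [x ->] := spectral_diag_form i A_normal.
  have := ger0_real (G_ge0 x); rewrite CrealE => /eqP xGx.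
  set y := x ^t* *m G *m x in xGx.
  have -> : x ^t* *m A *m x = y ^t* - y.
    by rewrite /A mulmxBr mulmxBl !trmxC_mul trmxCK !mulmxA.
  by clearbody y; rewrite !mxE xGx subrr.
rewrite (normalmx_spectralE A_normal) (_ : diag_mx _ = 0) ?mulmx0 ?mul0mx //.
by apply/matrixP=> i j; rewrite !mxE D0 mul0rn.
Qed.

(** Diagonalize [G] and take square roots of the eigenvalues, which are nonnegative. *)
Lemma psd_gram n (G : 'M[K]_n) :
  (forall x : 'cV[K]_n, 0 <= (x ^t* *m G *m x) ord0 ord0) ->
  exists X : 'M[K]_n, G = X ^t* *m X.
Proof.
move=> G_ge0; have G_normal : G \is normalmx.
  by apply/normalmxP; rewrite psd_hermitian.
have D_ge0 i : 0 <= spectral_diag G ord0 i.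
  by have [x ->] := spectral_diag_form i G_normal.
pose R := diag_mx (map_mx sqrtC (spectral_diag G)).
have RtR : R ^t* *m R = diag_mx (spectral_diag G).
  rewrite tr_diag_mx map_diag_mx mulmx_diag; congr diag_mx.
  apply/rowP=> i; rewrite !mxE /= conj_Creal ?ger0_real ?sqrtC_ge0 //.
  by rewrite -expr2 sqrtCK.
exists (R *m spectralmx G).
by rewrite trmxC_mul !mulmxA -(mulmxA _ (R ^t*)) RtR -normalmx_spectralE.
Qed.
End LinearAlgebra.

(** * Reduced words and balls in the free group *)

Lemma linvK : involutive linv.
Proof. by case=> a b; rewrite /linv /= negbK. Qed.

Lemma winv_cons x w : winv (x :: w) = rcons (winv w) (linv x).
Proof. by rewrite /winv /= rev_cons. Qed.

Lemma wmul_rcons u x v : wmul (rcons u x) v = wmul u (push x v).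
Proof. by rewrite /wmul foldr_rcons. Qed.

Lemma reduced_behead x w : reduced (x :: w) -> reduced w.
Proof. by case: w => //= y w /andP[]. Qed.

Lemma push_reduced x w : reduced w -> reduced (push x w).
Proof.
case: w => //= y w red_yw; case: ifPn => [_|ne]; last by rewrite /= ne.
exact: (@reduced_behead y).
Qed.

Lemma wmul_reduced u v : reduced v -> reduced (wmul u v).
Proof. by elim: u => //= x u IHu /IHu; exact: push_reduced. Qed.

Lemma size_push x w : (size (push x w) <= (size w).+1)%N.
Proof. by case: w => //= y w; case: ifP => //= _; rewrite ltnW. Qed.

Lemma size_wmul u v : (size (wmul u v) <= size u + size v)%N.
Proof. by elim: u => //= x u IHu; apply: leq_trans (size_push _ _) _. Qed.

Lemma size_winv w : size (winv w) = size w.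
Proof. by rewrite size_rev size_map. Qed.

Lemma push_reducedE x w : reduced (x :: w) -> push x w = x :: w.
Proof. by case: w => //= y w /andP[/negPf->]. Qed.

Lemma pushK x w : reduced w -> push (linv x) (push x w) = w.
Proof.
case: w => /= [_|y w red_yw]; first by rewrite linvK eqxx.
case: eqP => [yE|_]; last by rewrite /= linvK eqxx.
by rewrite push_reducedE -?yE.
Qed.

(** Left translation by a letter cancels in h^-1 g. This makes the shifts [P g] to [P (push x g)]
    preserve Gram matrices. *)
Lemma wmul_winv_push x h g : reduced g ->
  wmul (winv (push x h)) (push x g) = wmul (winv h) g.
Proof.
move=> red_g; case: h => [|y h]; first exact: pushK.
rewrite [push x (y :: h)]/=; case: eqP => [->|_]; first by rewrite winv_cons linvK wmul_rcons.
by rewrite winv_cons wmul_rcons pushK.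
Qed.

Lemma wmul_winvV h : reduced h -> wmul (winv h) h = [::].
Proof.
elim: h => // x h IHh red_xh.
rewrite winv_cons wmul_rcons /= eq_sym linvK eqxx IHh //.
exact: reduced_behead red_xh.
Qed.

Lemma mem_letters x : x \in letters.
Proof. by case: x => [[] []]. Qed.

Lemma mem_words_of_len n w : (w \in words_of_len n) = (size w == n).
Proof.
elim: n w => [|n IHn] [|x w] //.
  by apply/negP => /allpairsP[[? ?] []].
rewrite [size _]/= eqSS -IHn; apply/allpairsP/idP => [[[y u] [_ + [_ ->]]] //|wn].
by exists (x, w); split=> //; exact: mem_letters.
Qed.

Lemma words_of_len_uniq n : uniq (words_of_len n).
Proof.
elim: n => // n IHn; rewrite allpairs_uniq // => -[x u] [y v] _ _ /=.
by case=> -> ->.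
Qed.

Lemma mem_ball_seq s w : (w \in ball_seq s) = in_ball s w.
Proof.
rewrite mem_filter /in_ball; congr (_ && _).
apply/flatten_mapP/idP => [[n]|ws].
  by rewrite mem_iota add0n ltnS mem_words_of_len => /andP[_ ns] /eqP->.
by exists (size w); rewrite ?mem_words_of_len // mem_iota ltnS.
Qed.

Lemma ball_seq_uniq s : uniq (ball_seq s).
Proof.
rewrite filter_uniq //.
move: words_of_len words_of_len_uniq mem_words_of_len => wl wl_uniq mem_wl.
elim: s => [|s IHs]; first by rewrite /= cats0.
rewrite -[s.+2]addn1 iotaD map_cat flatten_cat cat_uniq IHs /= cats0.
rewrite wl_uniq andbT; apply/hasPn => w.
rewrite mem_wl => /eqP ws; apply/negP => wf.
have /flatten_mapP[n] : w \in flatten [seq wl i | i <- iota 0 s.+1] := wf.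
by rewrite mem_iota mem_wl ws add0n => /andP[_ +] /eqP nE; rewrite -nE ltnn.
Qed.

Lemma nil_ball_seq s : [::] \in ball_seq s.
Proof. by rewrite mem_ball_seq. Qed.

Lemma ball_seq_reduced s w : w \in ball_seq s -> reduced w.
Proof. by rewrite mem_ball_seq => /andP[]. Qed.

(** Word length is subadditive, so the quotients h^-1 g of elements of the ball of radius [s] have
    length at most 2s. *)
Lemma ball_seq_admissible (F : pred word) s :
  (forall w, in_ball s.*2 w -> F w) -> admissible F (ball_seq s).
Proof.
move=> FP; rewrite /admissible ball_seq_uniq andTb; apply/andP; split.
  by apply/allP=> w /ball_seq_reduced.
apply/allP=> h /[!mem_ball_seq] /andP[red_h hs].
apply/allP=> g /[!mem_ball_seq] /andP[red_g gs]; apply: FP.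
rewrite /in_ball wmul_reduced //= (leq_trans (size_wmul _ _)) //.
by rewrite size_winv -addnn leq_add.
Qed.

(** * Quadratic forms of matrix-valued functions and their realizations *)

Lemma eq_Qform d (C D : word -> 'M[CC]_d) S alpha :
  {in S &, forall h g, C (wmul (winv h) g) = D (wmul (winv h) g)} ->
  Qform C S alpha = Qform D S alpha.
Proof.
move=> CD; apply: eq_big_seq => g gS; apply: eq_big_seq => h hS.
by rewrite CD.
Qed.

Lemma Qform_lin d n (C : word -> 'M[CC]_d) (S : seq word)
    (B : word -> 'M[CC]_(d, n)) (x : 'cV[CC]_n) :
  Qform C S (fun g => B g *m x) =
  (x ^t* *m (\sum_(g <- S) \sum_(h <- S)
     B h ^t* *m C (wmul (winv h) g) *m B g) *m x) ord0 ord0.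
Proof.
rewrite mulmx_sumr mulmx_suml summxE; apply: eq_bigr => g _.
rewrite mulmx_sumr mulmx_suml summxE; apply: eq_bigr => h _.
by rewrite map_trmx trmxC_mul !mulmxA.
Qed.

(** The form is the squared norm of the vector obtained by summing [P g *m alpha g] over [S]. *)
Lemma Qform_gram d n (C : word -> 'M[CC]_d) (S : seq word)
    (P : word -> 'M[CC]_(n, d)) alpha :
  {in S &, forall h g, C (wmul (winv h) g) = P h ^t* *m P g} ->
  0 <= Qform C S alpha.
Proof.
move=> CP; suff -> : Qform C S alpha =
    ((\sum_(g <- S) P g *m alpha g) ^t* *m (\sum_(g <- S) P g *m alpha g))
      ord0 ord0 by exact: dotmx_col_ge0.
rewrite mulmx_sumr summxE; apply: eq_big_seq => g gS.
rewrite trmxC_sum mulmx_suml summxE; apply: eq_big_seq => h hS.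
by rewrite map_trmx CP // trmxC_mul !mulmxA.
Qed.

Lemma sum_seq_single (T : eqType) (V : zmodType) (S : seq T) (F : T -> V) g :
  uniq S -> g \in S -> (forall h, h \in S -> h != g -> F h = 0) ->
  \sum_(h <- S) F h = F g.
Proof.
move=> Su gS F0; rewrite (bigD1_seq g) //= big_seq_cond big1 ?addr0 //.
by move=> h /andP[]; exact: F0.
Qed.

(** The values C(h^-1 g) are assembled as blocks of one large positive semidefinite matrix. Its Gram
    factor [X], restricted to the summand of [g], is [P g]; orthogonality of the summands recovers
    each block. *)
Lemma Qform_factorization d (C : word -> 'M[CC]_d) (S : seq word) :
  uniq S -> (forall alpha, 0 <= Qform C S alpha) ->
  exists n (P : word -> 'M[CC]_(n, d)),
    {in S &, forall h g, C (wmul (winv h) g) = P h ^t* *m P g}.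
Proof.
move=> Su C_ge0; have [n [B BB]] := block_coordinates CC S d.
have [|X XE] := @psd_gram _ _ (\sum_(g <- S) \sum_(h <- S)
     B h ^t* *m C (wmul (winv h) g) *m B g).
  by move=> x; rewrite -Qform_lin.
exists n, (fun g => X *m B g ^t*) => h g hS gS.
rewrite trmxC_mul trmxCK -mulmxA (mulmxA (X ^t*)) -XE mulmx_suml mulmx_sumr.
rewrite (sum_seq_single Su gS) => [|g' g'S ne]; last first.
  rewrite mulmx_suml mulmx_sumr big1 // => h' _.
  by rewrite -mulmxA BB // (negPf ne) raddf0 !mulmx0.
rewrite mulmx_suml mulmx_sumr (sum_seq_single Su hS) => [|h' h'S ne].
  by rewrite !mulmxA BB // -!mulmxA BB // !eqxx mulmx1 mul1mx.
by rewrite !mulmxA BB // eq_sym (negPf ne) raddf0 !mul0mx.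
Qed.

(** * Unitary representations of the free group and extension of positive definite functions *)

Section Representation.
Variables (n : nat) (U : bool -> 'M[CC]_n).
Hypothesis U_unitary : forall b, U b \is unitarymx.

Definition letter_rep (x : letter) : 'M[CC]_n :=
  if x.2 then (U x.1) ^t* else U x.1.

Definition word_rep (w : word) : 'M[CC]_n :=
  foldr (fun x M => letter_rep x *m M) 1%:M w.

Lemma letter_rep_linv x : letter_rep (linv x) = (letter_rep x) ^t*.
Proof. by case: x => b []; rewrite /letter_rep /= ?trmxCK. Qed.

Lemma letter_rep_linvK x : letter_rep x *m letter_rep (linv x) = 1%:M.
Proof.
rewrite letter_rep_linv; apply/unitarymxP; case: x => b [];
by rewrite /letter_rep /= ?trmxC_unitary.
Qed.

Lemma word_rep_push x w : word_rep (push x w) = letter_rep x *m word_rep w.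
Proof.
case: w => //= y w; case: eqP => //= ->.
by rewrite mulmxA letter_rep_linvK mul1mx.
Qed.

Lemma word_rep_mul u v : word_rep (wmul u v) = word_rep u *m word_rep v.
Proof.
by elim: u => /= [|x u IHu]; rewrite ?mul1mx // word_rep_push IHu mulmxA.
Qed.

Lemma word_rep_inv w : word_rep (winv w) = (word_rep w) ^t*.
Proof.
elim: w => [|x w IHw]; first by rewrite trmx1 map_mx1.
have -> : winv (x :: w) = winv w ++ [:: linv x] by rewrite winv_cons cats1.
have cat u v : word_rep (u ++ v) = word_rep u *m word_rep v.
  by elim: u => /= [|y u ->]; rewrite ?mul1mx // mulmxA.
by rewrite cat IHw /= mulmx1 letter_rep_linv trmxC_mul.
Qed.

(** Matrix coefficients of a unitary representation have the realization [word_rep g *m X]. *)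
Lemma word_rep_posdef d (X : 'M[CC]_(n, d)) :
  posdef (fun g => X ^t* *m word_rep g *m X).
Proof.
move=> S alpha _; apply: (@Qform_gram _ n _ _ (fun g => word_rep g *m X)).
by move=> h g _ _; rewrite word_rep_mul word_rep_inv trmxC_mul !mulmxA.
Qed.

End Representation.

(* On the finite-dimensional space spanned by a realization of [C] the partial
   isometries [P g |-> P (x g)] extend to unitaries, hence to a representation of
   the free group, whose matrix coefficients at [P e] extend [C]. *)
Lemma posdef_extension s d (C : word -> 'M[CC]_d) :
  (forall alpha, 0 <= Qform C (ball_seq s) alpha) ->
  exists2 D : word -> 'M[CC]_d, posdef D &
    {in ball_seq s &, forall h g,
      D (wmul (winv h) g) = C (wmul (winv h) g)}.
Proof.
case/(Qform_factorization (ball_seq_uniq s)) => n [P CP].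
have /choice[U UP] b : exists U : 'M[CC]_n, U \is unitarymx /\
    forall g, g \in ball_seq s -> push (b, false) g \in ball_seq s ->
      U *m P g = P (push (b, false) g).
  have [|U uU UE] := @unitary_of_equal_block_gram _ _
    [seq g <- ball_seq s | push (b, false) g \in ball_seq s] _ _
    P (fun g => P (push (b, false) g)).
    move=> h g; rewrite mem_filter => /andP[xh hs].
    rewrite mem_filter => /andP[xg gs].
    rewrite -(CP h g) // -(wmul_winv_push (b, false)); first exact: CP.
    exact: ball_seq_reduced gs.
  by exists U; split=> // g gs xgs; rewrite UE // mem_filter xgs.
have uU b : U b \is unitarymx by case: (UP b).
have stepE x g : g \in ball_seq s -> push x g \in ball_seq s ->
    letter_rep U x *m P g = P (push x g).
  case: x => b []; last by case: (UP b) => _; apply.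
  (* For an inverse letter, the generator moves [P (push x g)] back to [P g]; its adjoint undoes
     this. *)
  move=> gs xgs; have [_ /(_ _ xgs)] := UP b.
  have /= -> := pushK (b, true) (ball_seq_reduced gs).
  by move=> <- //; rewrite /letter_rep /= mulmxA unitarymx_mulCl ?mul1mx.
(* Tails of reduced words stay in the ball, so [P g] is reached from [P [::]] one letter at a
   time. *)
have repE g : g \in ball_seq s -> word_rep U g *m P [::] = P g.
  elim: g => [|x g IHg] xgs /=; first by rewrite mul1mx.
  have gs : g \in ball_seq s.
    move: xgs; rewrite !mem_ball_seq => /andP[red_xg xgs].
    by rewrite /in_ball (reduced_behead red_xg) ltnW.
  have xgE : push x g = x :: g by rewrite push_reducedE // (ball_seq_reduced xgs).
  by rewrite -mulmxA IHg // stepE // xgE.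
exists (fun g => (P [::]) ^t* *m word_rep U g *m P [::]).
  exact: word_rep_posdef.
move=> h g hs gs; rewrite word_rep_mul // word_rep_inv mulmxA -mulmxA repE //.
by rewrite -trmxC_mul repE // CP.
Qed.

(** * The cone of positive definite functions and a linear system along a self-map *)

Lemma QformZ d c (C : word -> 'M[CC]_d) S alpha :
  Qform (fun g => c *: C g) S alpha = c * Qform C S alpha.
Proof.
rewrite /Qform mulr_sumr; apply: eq_bigr => g _.
rewrite mulr_sumr; apply: eq_bigr => h _.
by rewrite -scalemxAr -scalemxAl mxE.
Qed.

Lemma QformB d (C D : word -> 'M[CC]_d) S alpha :
  Qform (fun g => C g - D g) S alpha = Qform C S alpha - Qform D S alpha.
Proof.
rewrite /Qform -sumrB; apply: eq_bigr => g _.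
rewrite -sumrB; apply: eq_bigr => h _.
by rewrite mulmxBr mulmxBl [LHS]mxE [X in _ + X]mxE.
Qed.

Lemma Qform_sum d n (C : 'I_n -> word -> 'M[CC]_d) S alpha :
  Qform (fun g => \sum_(i < n) C i g) S alpha = \sum_(i < n) Qform (C i) S alpha.
Proof.
rewrite /Qform [RHS]exchange_big /=; apply: eq_bigr => g _.
rewrite [RHS]exchange_big /=; apply: eq_bigr => h _.
by rewrite mulmx_sumr mulmx_suml summxE.
Qed.

Lemma posdefZ d c (C : word -> 'M[CC]_d) :
  0 <= c -> posdef C -> posdef (fun g => c *: C g).
Proof. by move=> c0 Cp S alpha /Cp ?; rewrite QformZ mulr_ge0. Qed.

Lemma posdef_sum d n (C : 'I_n -> word -> 'M[CC]_d) :
  (forall i, posdef (C i)) -> posdef (fun g => \sum_(i < n) C i g).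
Proof.
by move=> Cp S alpha SP; rewrite Qform_sum sumr_ge0 // => i _; exact: Cp.
Qed.

Lemma telescope_ord (U : zmodType) (a : nat -> U) N :
  \sum_(k < N) (a k - a k.+1) = a 0%N - a N.
Proof.
elim: N => [|N IHN]; first by rewrite big_ord0 subrr.
by rewrite big_ord_recr /= IHN addrA subrK.
Qed.

(* The system [Ch v = mu v Ch (f v) + E v] is solved by iterating it until the
   orbit closes up ([f^N = id]) or the accumulated weight vanishes. *)
Lemma functional_extension (V : finType) (f : V -> V) (mu : V -> CC) (P : CC)
    (N s d : nat) (C : V -> word -> 'M[CC]_d) :
  (forall v, 0 <= mu v) -> P < 1 ->
  (forall v, \prod_(j < N) mu (iter j f v) = P) ->
  P = 0 \/ (forall v, iter N f v = v) ->
  (forall v alpha,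
    0 <= Qform (fun g => C v g - mu v *: C (f v) g) (ball_seq s) alpha) ->
  exists Ch : V -> word -> 'M[CC]_d,
  [/\ forall v, posdef (Ch v),
      forall v, {in ball_seq s &, forall h g,
        Ch v (wmul (winv h) g) = C v (wmul (winv h) g)} &
      forall v, posdef (fun g => Ch v g - mu v *: Ch (f v) g)].
Proof.
move=> mu_ge0 P_lt1 muP closing C_ge0.
have /choice[E EP] v : exists D, posdef D /\ {in ball_seq s &, forall h g,
    D (wmul (winv h) g) =
    C v (wmul (winv h) g) - mu v *: C (f v) (wmul (winv h) g)}.
  by have [D Dp DE] := posdef_extension (C_ge0 v); exists D.
pose w k v := \prod_(j < k) mu (iter j f v).
have w_ge0 k v : 0 <= w k v by apply: prodr_ge0.
(* Both closing conditions say the same here: either both sides are zero or the orbit has returned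
   to [v]. *)
have wNE (F : V -> 'M[CC]_d) v : w N v *: F (iter N f v) = P *: F v.
  by rewrite /w muP; case: closing => [->|->] //; rewrite !scale0r.
have wSl k v : w k.+1 v = mu v * w k (f v).
  rewrite /w big_ord_recl /=; congr (_ * _).
  by apply: eq_bigr => i _; rewrite -iterSr.
have wSr k v : w k.+1 v = w k v * mu (iter k f v) by rewrite /w big_ord_recr.
have P1_neq0 : 1 - P != 0 by rewrite subr_eq0 eq_sym lt_eqF.
have P1_ge0 : 0 <= (1 - P)^-1 by rewrite invr_ge0 subr_ge0 ltW.
have w0E v (F : V -> 'M[CC]_d) : w 0%N v *: F (iter 0 f v) = F v.
  by rewrite /w big_ord0 scale1r.
(* This is the series of all [w k v *: E (iter k f v) g], summed in blocks of [N] terms: each block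
   is [P] times the previous one. *)
exists (fun v g => (1 - P)^-1 *: \sum_(k < N) w k v *: E (iter k f v) g).
have rel v g : (1 - P)^-1 *: (\sum_(k < N) w k v *: E (iter k f v) g)
    - mu v *: ((1 - P)^-1 *: \sum_(k < N) w k (f v) *: E (iter k f (f v)) g)
    = E v g.
  rewrite scalerA mulrC -scalerA -scalerBr scaler_sumr -sumrB.
  under eq_bigr do rewrite scalerA -wSl -iterSr.
  rewrite (telescope_ord (fun k => w k v *: E (iter k f v) g)).
  rewrite (wNE (E ^~ g)) (w0E _ (E ^~ g)).
  by rewrite -{1}[E v g]scale1r -scalerBl scalerA mulVf ?scale1r.
split=> v.
- apply: posdefZ => //; apply: posdef_sum => k; apply: posdefZ => //.
  by have [] := EP (iter k f v).
- move=> h g hs gs; set x := wmul _ _.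
  have step k : w k v *: E (iter k f v) x =
      w k v *: C (iter k f v) x - w k.+1 v *: C (iter k.+1 f v) x.
    have [_ ->] := EP (iter k f v) => //.
    by rewrite scalerBr scalerA -wSr.
  under eq_bigr do rewrite step.
  rewrite (telescope_ord (fun k => w k v *: C (iter k f v) x)).
  rewrite (wNE (C ^~ x)) (w0E _ (C ^~ x)).
  by rewrite -{1}[C v x]scale1r -scalerBl scalerA mulVf ?scale1r.
- rewrite (_ : (fun g => _) = E v); first by have [] := EP v.
  exact/funext/rel.
Qed.

(** * Relative energy as positivity of [C - mu D] *)

Lemma energy_r_ge0 r d (C D : word -> 'M[CC]_d) : (0 <= energy_r r C D)%E.
Proof.
by apply: le_ereal_inf_tmp => _ [M [M_ge0 _] <-]; rewrite lee_fin.
Qed.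

Lemma energy_r_le r d (C D : word -> 'M[CC]_d) (M : RR) :
  0 <= M -> (forall alpha, complex.Re (Qform D (ball_seq r./2) alpha)
    <= M * complex.Re (Qform C (ball_seq r./2) alpha)) ->
  (energy_r r C D <= M%:E)%E.
Proof. by move=> M_ge0 CD; apply: ereal_inf_lbound; exists M. Qed.

Lemma energy_r_attained r d (C D : word -> 'M[CC]_d) (L : RR) alpha :
  energy_r r C D = L%:E ->
  0 <= complex.Re (Qform C (ball_seq r./2) alpha) ->
  complex.Re (Qform D (ball_seq r./2) alpha)
    <= L * complex.Re (Qform C (ball_seq r./2) alpha).
Proof.
move=> CDL; set q := complex.Re (Qform C _ _) => q_ge0.
apply/ler_addgt0Pr => e e_gt0.
(* The slack is divided by [q + 1] because [q] may be zero; multiplied by [q] it stays below [e]. *)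
have : (energy_r r C D < (L + e / (q + 1))%:E)%E.
  by rewrite CDL lte_fin ltrDl divr_gt0 // ltr_wpDl.
case/ereal_inf_lt => _ [M [_ /(_ alpha) le_M] <-]; rewrite lte_fin => M_lt.
apply: le_trans le_M _; rewrite -/q.
apply: le_trans (ler_wpM2r q_ge0 (ltW M_lt)) _.
rewrite mulrDl lerD2l -mulrA ler_piMr ?(ltW e_gt0) //.
rewrite mulrC ler_pdivrMr ?mul1r ?lerDl // ltr_wpDl //.
Qed.

Lemma NSPD_Qform_ge0 r d (C : word -> 'M[CC]_d) alpha :
  NSPD r C -> 0 <= Qform C (ball_seq r./2) alpha.
Proof.
case=> -[Cp _] _; apply: Cp; apply: ball_seq_admissible => w /andP[red_w ws].
rewrite /in_ball red_w (leq_trans ws) //.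
(* Halving rounds down, so twice [r./2] is at most [r] for odd [r] too. *)
by rewrite -[leqRHS]odd_double_half leq_addl.
Qed.

Lemma posdef_Qform_ge0 s d (C : word -> 'M[CC]_d) alpha :
  posdef C -> 0 <= Qform C (ball_seq s) alpha.
Proof. by apply; apply: ball_seq_admissible => w /andP[]. Qed.

(** In a realization, [C [::]] is the Gram matrix of each [P h], so all the [P h] vanish. *)
Lemma posdef_null s d (C : word -> 'M[CC]_d) :
  (forall alpha, 0 <= Qform C (ball_seq s) alpha) -> C [::] = 0 ->
  {in ball_seq s &, forall h g, C (wmul (winv h) g) = 0}.
Proof.
move=> /(Qform_factorization (ball_seq_uniq s))[n [P CP]] C0 h g hs gs.
have P0 : P h = 0.
  by apply: dotmx_mx_eq0; rewrite -CP // wmul_winvV ?(ball_seq_reduced hs).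
by rewrite CP // P0 trmx0 map_mx0 mul0mx.
Qed.

Lemma Re_ge0 (z : CC) : 0 <= z -> 0 <= complex.Re z.
Proof. by rewrite lecE => /andP[_]. Qed.

Lemma subC_ge0 (L : RR) (z w : CC) : 0 < L -> 0 <= z -> 0 <= w ->
  (0 <= z - (L^-1)%:C%C * w) = (complex.Re w <= L * complex.Re z).
Proof.
move=> L_gt0 /ger0_real/RRe_real zE /ger0_real/RRe_real wE.
rewrite -[in LHS]zE -[in LHS]wE -rmorphM -rmorphB /= ler0c subr_ge0.
by rewrite ler_pdivrMl.
Qed.

Lemma Qform_dim0 (C : word -> 'M[CC]_0) S alpha : Qform C S alpha = 0.
Proof. by rewrite /Qform big1 // => g _; rewrite big1 // => h _; rewrite mxE big_ord0. Qed.

Lemma energy_r_ge1 r d (C D : word -> 'M[CC]_d.+1) :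
  C [::] = 1%:M -> D [::] = 1%:M -> (1 <= energy_r r C D)%E.
Proof.
move=> C1 D1; apply: le_ereal_inf_tmp => _ [M [_ MP] <-]; rewrite lee_fin.
(* The test vector is a basis vector placed at the identity, where normalization gives both forms
   the value 1; its existence uses positive dimension. *)
pose alpha (g : word) : 'cV[CC]_d.+1 :=
  if g == [::] then delta_mx ord0 ord0 else 0.
have Q1 (A : word -> 'M[CC]_d.+1) : A [::] = 1%:M ->
    Qform A (ball_seq r./2) alpha = 1.
  move=> A1; rewrite /Qform (sum_seq_single (ball_seq_uniq _) (nil_ball_seq _)).
    rewrite (sum_seq_single (ball_seq_uniq _) (nil_ball_seq _)).
      rewrite /alpha eqxx A1 mulmx1 map_delta_mx trmx_delta mul_delta_mx.
      by rewrite mxE !eqxx.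
    by move=> h _ /negPf h0; rewrite /alpha h0 map_mx0 trmx0 !mul0mx mxE.
  move=> g _ /negPf g0; rewrite big1 // => h _.
  by rewrite /alpha g0 mulmx0 mxE.
by have := MP alpha; rewrite !Q1 //= mulr1.
Qed.

(* The largest [mu] such that [C - mu D] is positive definite on the ball; it is
   [0] when the energy is infinite. *)
Definition energy_weight r d (C D : word -> 'M[CC]_d) : CC :=
  if energy_r r C D is L%:E%E then (L^-1)%:C%C else 0.

Lemma energy_weight_itv r d (C D : word -> 'M[CC]_d.+1) :
  C [::] = 1%:M -> D [::] = 1%:M -> 0 <= energy_weight r C D <= 1.
Proof.
move=> C1 D1; have := energy_r_ge1 r C1 D1.
rewrite /energy_weight; case: energy_r => [L| |]; rewrite ?lexx ?ler01 //.
rewrite lee_fin => L1; have L0 : 0 < L by apply: lt_le_trans L1.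
by rewrite ler0c invr_ge0 (ltW L0) (_ : 1 = 1%:C%C) // lecR invf_le1.
Qed.

Lemma energy_weight_Qform_ge0 r d (C D : word -> 'M[CC]_d.+1) alpha :
  NSPD r C -> NSPD r D ->
  0 <= Qform (fun g => C g - energy_weight r C D *: D g) (ball_seq r./2) alpha.
Proof.
move=> Cp Dp; have C_ge0 := NSPD_Qform_ge0 alpha Cp.
have D_ge0 := NSPD_Qform_ge0 alpha Dp.
rewrite QformB QformZ /energy_weight.
have := energy_r_ge1 r (proj2 Cp) (proj2 Dp).
case CDE: energy_r => [L| |]; rewrite ?mul0r ?subr0 //.
rewrite lee_fin => L1; rewrite subC_ge0 ?(lt_le_trans _ L1) //.
exact: energy_r_attained CDE (Re_ge0 C_ge0).
Qed.

(** Positivity of [A - B / L] on every ball bounds the energy by [L] on every ball, hence the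
    supremum; an infinite right-hand side needs no bound. *)
Lemma energy_le_of_weight r d (C D A B : word -> 'M[CC]_d.+1) :
  C [::] = 1%:M -> D [::] = 1%:M -> posdef A -> posdef B ->
  posdef (fun g => A g - energy_weight r C D *: B g) ->
  (energy A B <= energy_r r C D)%E.
Proof.
move=> C1 D1 Ap Bp; rewrite /energy_weight.
have := energy_r_ge1 r C1 D1.
case: energy_r => [L| |] //; last by move=> *; rewrite leey.
rewrite lee_fin => L1 ABp; have L0 : 0 < L by apply: lt_le_trans L1.
apply: ge_ereal_sup => _ [q _ <-]; apply: energy_r_le; first exact: ltW.
move=> alpha; have := posdef_Qform_ge0 q./2 alpha ABp.
by rewrite QformB QformZ subC_ge0 ?posdef_Qform_ge0.
Qed.

(** * Simultaneous extension over trees and cycles *)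

Lemma tree_extension (V : finType) (E : rel V) r d
    (C : V -> word -> 'M[CC]_d.+1) :
  rooted_in_tree E -> (forall v, NSPD r (C v)) ->
  exists Ch : V -> word -> 'M[CC]_d.+1,
  [/\ forall v, posdef (Ch v),
      forall v, {in ball_seq r./2 &, forall h g,
        Ch v (wmul (winv h) g) = C v (wmul (winv h) g)} &
      forall v w, E v w ->
        posdef (fun g => Ch v g - energy_weight r (C v) (C w) *: Ch w g)].
Proof.
case=> root [root_sink [out1 conn]] Cp.
(* [f] is the parent map. The default makes the root a fixed point, and the weight 0 given to the
   root below cuts this artificial loop. *)
pose f v := odflt v [pick w | E v w].
pose mu v := if v == root then 0 else energy_weight r (C v) (C (f v)).
have edgeP v w : E v w -> v != root /\ w = f v.
  move=> vw; have v_root : v != root.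
    by apply: contraTneq vw => ->; exact: root_sink.
  split=> //; rewrite /f; case: pickP => [w' vw'|/(_ w)]; last by rewrite vw.
  have /eqP/card1P := out1 v v_root.
  by case=> u uP; have := uP w; have := uP w'; rewrite !inE vw vw' => /esym/eqP-> /esym/eqP.
have root_reach v : fconnect f v root.
  apply: connect_sub (conn v) => x y /edgeP[_ ->]; exact: fconnect1.
have mu_ge0 v : 0 <= mu v.
  rewrite /mu; case: ifP => // _.
  by case/andP: (energy_weight_itv r (proj2 (Cp v)) (proj2 (Cp (f v)))).
(* Every orbit meets the root in fewer than [#|V|] steps, and contributes its zero factor there. *)
have muP v : \prod_(j < #|V|) mu (iter j f v) = 0.
  have lt_root : (findex f v root < #|V|)%N.
    by apply: leq_trans (findex_max (root_reach v)) _; exact: max_card.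
  rewrite (bigD1 (Ordinal lt_root)) //= iter_findex //.
  by rewrite /mu eqxx mul0r.
have [|Ch [Chp ChE ChC]] :=
    functional_extension mu_ge0 ltr01 muP (or_introl erefl) (s := r./2) (C := C).
  move=> v alpha; rewrite /mu; case: ifP => _.
    by rewrite QformB QformZ mul0r subr0 NSPD_Qform_ge0.
  exact: energy_weight_Qform_ge0.
exists Ch; split=> // v w /edgeP[v_root ->].
by have := ChC v; rewrite /mu (negPf v_root).
Qed.

Lemma cycle_extension (V : finType) (E : rel V) r d
    (C : V -> word -> 'M[CC]_d.+1) :
  directed_cycle E -> (forall v, NSPD r (C v)) ->
  exists Ch : V -> word -> 'M[CC]_d.+1,
  [/\ forall v, posdef (Ch v),
      forall v, {in ball_seq r./2 &, forall h g,
        Ch v (wmul (winv h) g) = C v (wmul (winv h) g)} &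
      forall v w, E v w ->
        posdef (fun g => Ch v g - energy_weight r (C v) (C w) *: Ch w g)].
Proof.
case=> /card_gt0P[v0 _] [f [f_inj [EE conn]]] Cp.
pose mu v := energy_weight r (C v) (C (f v)).
have mu_itv v : 0 <= mu v <= 1.
  exact: energy_weight_itv (proj2 (Cp v)) (proj2 (Cp (f v))).
have C_ge0 v alpha :
    0 <= Qform (fun g => C v g - mu v *: C (f v) g) (ball_seq r./2) alpha.
  exact: energy_weight_Qform_ge0.
pose P := \prod_v mu v.
have P_le1 : P <= 1 by apply: prodr_ile1 => v _; exact: mu_itv.
suff [Ch [Chp ChE ChC]] : exists Ch : V -> word -> 'M[CC]_d.+1,
  [/\ forall v, posdef (Ch v),
      forall v, {in ball_seq r./2 &, forall h g,
        Ch v (wmul (winv h) g) = C v (wmul (winv h) g)} &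
      forall v, posdef (fun g => Ch v g - mu v *: Ch (f v) g)].
  exists Ch; split; [exact: Chp|exact: ChE|move=> v w].
  by rewrite EE => /eqP ->; rewrite -/(mu v); exact: ChC.
have orderE v : order f v = #|V|.
  by apply: eq_card => x; rewrite inE conn.
have [P1|P_neq1] := eqVneq P 1; last first.
  have P_lt1 : P < 1 by rewrite lt_neqAle P_neq1.
  apply: (@functional_extension _ f mu P #|V|) => //.
  - by move=> v; case/andP: (mu_itv v).
  (* One turn around the cycle visits every vertex once, so the product does not depend on the
     starting point. *)
  - move=> v; have -> : P = \prod_(x <- orbit f v) mu x.
      apply: perm_big; apply: uniq_perm => [||x].
      + exact: index_enum_uniq.
      + exact: orbit_uniq.
      + by rewrite mem_index_enum -fconnect_orbit conn.
    rewrite (big_nth v) size_traject orderE big_mkord.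
    by apply: eq_bigr => i _; rewrite nth_traject ?orderE.
  - by right=> v; rewrite -(orderE v) iter_order.
(* Factors in [0, 1] with product 1 are all equal to 1. *)
have mu1 v : mu v = 1.
  apply/eqP; rewrite eq_le; case/andP: (mu_itv v) => mu0 ->.
  rewrite andTb -P1 /P (bigD1 v) //= ler_piMr //.
  by apply: prodr_ile1 => u _; exact: mu_itv.
(* With weight 1, normalization makes [C u - C (f u)] vanish at the identity, hence on the ball;
   going around the cycle identifies all the functions with that of [v0]. *)
have CE v : {in ball_seq r./2 &, forall h g,
    C v (wmul (winv h) g) = C v0 (wmul (winv h) g)}.
  have <- := iter_findex (conn v0 v); elim: (findex f v0 v) => //= k IHk.
  move=> h g hs gs; rewrite -IHk //; set u := iter k f v0.
  have := posdef_null (C_ge0 u) _ hs gs.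
  rewrite mu1 !scale1r (proj2 (Cp u)) (proj2 (Cp (f u))) subrr => /(_ erefl).
  by move/eqP; rewrite subr_eq0 => /eqP ->.
have [D Dp DE] := posdef_extension (fun alpha => NSPD_Qform_ge0 alpha (Cp v0)).
exists (fun=> D); split=> // v.
  by move=> h g hs gs; rewrite DE // CE.
by move=> S alpha _; rewrite QformB QformZ mu1 mul1r subrr.
Qed.

Lemma graph_extension (V : finType) (E : rel V) r d
    (C : V -> word -> 'M[CC]_d) :
  rooted_in_tree E \/ directed_cycle E -> (forall v, NSPD r (C v)) ->
  exists Ch : V -> word -> 'M[CC]_d,
  [/\ forall v, posdef (Ch v),
      forall v, {in ball_seq r./2 &, forall h g,
        Ch v (wmul (winv h) g) = C v (wmul (winv h) g)} &
      forall v w, E v w ->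
        (energy (Ch v) (Ch w) <= energy_r r (C v) (C w))%E].
Proof.
case: d C => [|d] C EP Cp.
  (* In dimension 0 all forms and energies are zero, so the configuration extends itself. *)
  exists C; split=> // [v S alpha _|v w _]; first by rewrite Qform_dim0.
  apply: ge_ereal_sup => _ [q _ <-]; apply: le_trans (energy_r_ge0 _ _ _).
  by apply: energy_r_le => // alpha; rewrite !Qform_dim0 mulr0.
suff [Ch [Chp ChE ChC]] : exists Ch : V -> word -> 'M[CC]_d.+1,
  [/\ forall v, posdef (Ch v),
      forall v, {in ball_seq r./2 &, forall h g,
        Ch v (wmul (winv h) g) = C v (wmul (winv h) g)} &
      forall v w, E v w ->
        posdef (fun g => Ch v g - energy_weight r (C v) (C w) *: Ch w g)].
  exists Ch; split=> // v w vw.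
  by apply: energy_le_of_weight (ChC v w vw); rewrite // (proj2 (Cp _)).
by case: EP => EP; [exact: tree_extension|exact: cycle_extension].
Qed.

(** * The value of the energy cost *)

Lemma encost_conf_ge1 r eps (V : finType) (E : rel V) d
    (C : V -> word -> 'M[CC]_d) : (1 <= encost_conf r eps E C)%E.
Proof. by apply: le_ereal_inf_tmp => _ [M [M1 _] <-]; rewrite lee_fin. Qed.

Theorem theorem1 (V : finType) (E : rel V) :
  rooted_in_tree E \/ directed_cycle E ->
  forall (r : nat) (eps : Rdefinitions.R), (0 < eps)%R ->
    encost r eps E = 1%E.
Proof.
move=> EP r eps eps_gt0; apply/eqP; rewrite eq_le; apply/andP; split.
  apply: ge_ereal_sup => _ [d [C [Cp ->]]].
  have [Ch [Chp ChE ChC]] := graph_extension EP Cp.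
  have close (A B : word -> 'M[CC]_d) :
      (forall alpha, 0 <= Qform A (ball_seq r./2) alpha) ->
      {in ball_seq r./2 &, forall h g,
        B (wmul (winv h) g) = A (wmul (winv h) g)} ->
      (energy_r r A B <= (1 + eps)%:E)%E.
    move=> A_ge0 AB; apply: energy_r_le => [|alpha].
      by rewrite addr_ge0 // ltW.
    by rewrite (eq_Qform _ AB) ler_peMl ?Re_ge0 // lerDl ltW.
  apply: ereal_inf_lbound; exists 1 => //; split=> //; exists Ch; split=> //.
  split=> [v|v w vw]; first split.
  - by apply: close => // alpha; exact: NSPD_Qform_ge0.
  - apply: close => [alpha|h g hs gs]; first exact: posdef_Qform_ge0.
    by rewrite ChE.
  - by rewrite mul1e leeD2r // ChC.
(* The lower bound on the supremum requires some configuration to exist; the zero-dimensional one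
   serves. *)
apply: le_trans (encost_conf_ge1 r eps E (fun _ _ => 0 : 'M[CC]_0)) _.
apply: ereal_sup_ubound; exists 0%N, (fun _ _ => 0); split=> // v.
split; last by rewrite [RHS]flatmx0.
split=> [S alpha _|S alpha _ _ g _]; first by rewrite Qform_dim0.
exact: flatmx0.
Qed.
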